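(* Let $q\in(0,1]$, let $\alpha=(\alpha_1,\alpha_2,\alpha_3)\in\mathbf{R}^3$ with $\alpha_1\alpha_2\alpha_3\neq 0$, and let $k\in\mathbf{R}$. Consider the fractional Euler top system with parameters $$D_t^q x^1=\alpha_1x^2x^3,\qquad D_t^q x^2=\alpha_2x^1x^3-kx^1,\qquad D_t^q x^3=\alpha_3x^1x^2 .$$ It has the following two fractional almost Poisson realizations, each with the indicated fractional Casimir. (i) $(\mathbf{R}^3,P_1^\alpha,H_1^\alpha)$ with fractional Casimir $C_1^\alpha$, where $$P_1^\alpha(x,k)=\begin{pmatrix}0&k&-\alpha_3x^2\\-k&0&-\frac{\alpha_2\alpha_3}{\alpha_1}x^1\\ \alpha_3x^2&\frac{\alpha_2\alpha_3}{\alpha_1}x^1&0\end{pmatrix},$$ $$H_1^\alpha(x)=\frac{1}{\Gamma(q+2)}\Big[(x^1)^{1+q}-\frac{\alpha_1}{\alpha_3}(x^3)^{1+q}\Big],$$ $$C_1^\alpha(x,k)=\frac{1}{\Gamma(q+2)}\big[\alpha_2(x^1)^{1+q}-\alpha_1(x^2)^{1+q}\big]-\frac{k\alpha_1}{\Gamma(q+1)\alpha_3}(x^3)^q .$$ (ii) $(\mathbf{R}^3,P_2^\alpha,H_2^\alpha)$ with fractional Casimir $C_2^\alpha$, where $$P_2^\alpha(x)=\begin{pmatrix}0&x^3&0\\-x^3&0&-\frac{\alpha_3}{\alpha_1}x^1\\0&\frac{\alpha_3}{\alpha_1}x^1&0\end{pmatrix},$$ $$H_2^\alpha(x,k)=\frac{1}{\Gamma(q+2)}\big[-\alpha_2(x^1)^{1+q}+\alpha_1(x^2)^{1+q}\big]+\frac{k\alpha_1}{\Gamma(q+1)\alpha_3}(x^3)^q,$$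 $$C_2^\alpha(x)=\frac{1}{\Gamma(q+2)}\big[\alpha_3(x^1)^{1+q}-\alpha_1(x^3)^{1+q}\big].$$
   Context: Superscripts on $x^1,x^2,x^3$ are coordinate indices; powers are written outside parentheses, e.g. $(x^1)^{1+q}$. $\Gamma$ is the Euler Gamma function. For $0<q<1$, the Caputo derivative of order $q$ (base point $0$) of a function of one variable is $D_t^qf(t)=\frac{1}{\Gamma(1-q)}\int_0^t(t-s)^{-q}f'(s)\,ds$; for $q=1$, $D_t^1f=df/dt$. The Caputo partial derivative $D_{x^i}^q$ is this operator applied in the variable $x^i$ (base point $0$) with the other variables fixed. Real powers $(x^i)^{m}$ and Caputo partial derivatives are considered where the coordinates involved are positive. For a function $F$ on $\mathbf{R}^3$ put $\nabla^qF=(D_{x^1}^qF,D_{x^2}^qF,D_{x^3}^qF)^T$. A fractional system $D_t^qx^i=f^i(x^1,x^2,x^3)$, $i=1,2,3$, has the fractional almost Poisson realization $(\mathbf{R}^3,P,H)$, where $P=(P^{ij}(x))$ is a matrix of functions and $H$ a function (Hamiltonian), if $P$ is skew-symmetric and the system can be written as $D_t^qx(t)=P(x(t))\cdot\nabla^qH(x(t))$, i.e. $f=P\cdot\nabla^qH$ with $f=(f^1,f^2,f^3)^T$. A fractional Casimir of $(\mathbf{R}^3,P,H)$ is a function $C$ with $[C,g]^q=0$ for all functions $g$, where $[f,g]^q=\sum_{i,j}P^{ij}\,D_{x^i}^qf\,D_{x^j}^qg$ is the associated fractional Leibniz bracket; that is, $P(x)\cdot\nabla^qC(x)=0$. *)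

(* Defs.v *)
From mathcomp Require Export all_boot all_order all_algebra.
From mathcomp Require Export all_classical all_reals all_analysis.
Export GRing.Theory Num.Theory Order.TTheory numFieldNormedType.Exports.

Set Implicit Arguments.
Unset Strict Implicit.
Unset Printing Implicit Defensive.

Local Open Scope classical_set_scope.
Local Open Scope ring_scope.

(* Euler's integral; only meaningful for 0 < z. *)
Definition Gamma (R : realType) (z : R) : R :=
  \int[lebesgue_measure]_(t in `]0, +oo[) (t `^ (z - 1) * expR (- t)).

Definition caputo_integrand (R : realType) (q : R) (f : R -> R) (t s : R) : R :=
  (t - s) `^ (- q) * derive1 f s.

(* Caputo derivative with base point 0, for 0 < q <= 1 and (if q < 1) 0 < t. *)
Definition caputo (R : realType) (q : R) (f : R -> R) (t : R) : R :=
  if q == 1 then derive1 f t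
  else (Gamma (1 - q))^-1 *
       \int[lebesgue_measure]_(s in `]0, t[) caputo_integrand q f t s.

(* [caputo] is total, as derivatives and integrals in the library are: this
   predicate says that its value at t is not a default one. *)
Definition caputo_derivable (R : realType) (q : R) (f : R -> R) (t : R) : Prop :=
  if q == 1 then derivable f t 1
  else (forall s, 0 < s < t -> derivable f s 1) /\
       lebesgue_measure.-integrable `]0, t[ (EFin \o caputo_integrand q f t).

(* Points of R^3 are column vectors; the coordinates x^1, x^2, x^3 are
   x 0 0, x 1 0, x 2 0. *)
Definition vec3 (R : realType) (a b c : R) : 'cV[R]_3 :=
  \col_i [:: a; b; c]`_i.

Definition mx3 (R : realType) (rows : seq (seq R)) : 'M[R]_3 :=
  \matrix_(i, j) (nth [::] rows i)`_j.

Definition positive_point (R : realType) (x : 'cV[R]_3) : Prop :=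
  forall i, 0 < x i 0.

Definition slice (R : realType) (F : 'cV[R]_3 -> R) (x : 'cV[R]_3) (i : 'I_3)
    (s : R) : R :=
  F (\col_j if j == i then s else x j 0).

Definition caputo_partial (R : realType) (q : R) (i : 'I_3)
    (F : 'cV[R]_3 -> R) (x : 'cV[R]_3) : R :=
  caputo q (slice F x i) (x i 0).

Definition caputo_grad (R : realType) (q : R) (F : 'cV[R]_3 -> R)
    (x : 'cV[R]_3) : 'cV[R]_3 :=
  \col_i caputo_partial q i F x.

Definition caputo_differentiable (R : realType) (q : R) (F : 'cV[R]_3 -> R)
    (x : 'cV[R]_3) : Prop :=
  forall i, caputo_derivable q (slice F x i) (x i 0).

(* The fractional system D_t^q x = f(x) is given by its right-hand side f. *)
Definition almost_poisson_realization (R : realType) (q : R)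
    (f : 'cV[R]_3 -> 'cV[R]_3) (P : 'cV[R]_3 -> 'M[R]_3)
    (H : 'cV[R]_3 -> R) : Prop :=
  (forall x, (P x)^T = - P x) /\
  (forall x, positive_point x ->
     caputo_differentiable q H x /\ f x = P x *m caputo_grad q H x).

Definition leibniz_bracket (R : realType) (q : R) (P : 'cV[R]_3 -> 'M[R]_3)
    (f g : 'cV[R]_3 -> R) (x : 'cV[R]_3) : R :=
  \sum_i \sum_j P x i j * caputo_partial q i f x * caputo_partial q j g x.

(* For skew-symmetric P the last clause amounts to P x *m caputo_grad q C x = 0:
   take for g the functions x |-> (x^j)^(1+q). *)
Definition fractional_casimir (R : realType) (q : R) (P : 'cV[R]_3 -> 'M[R]_3)
    (C : 'cV[R]_3 -> R) : Prop :=
  forall x, positive_point x ->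
    caputo_differentiable q C x /\
    (forall g : 'cV[R]_3 -> R, leibniz_bracket q P C g x = 0).

Section EulerTop.
Variables (R : realType) (q a1 a2 a3 k : R).
Implicit Type x : 'cV[R]_3.

Definition euler_top x : 'cV[R]_3 :=
  vec3 (a1 * x 1 0 * x 2 0)
       (a2 * x 0 0 * x 2 0 - k * x 0 0)
       (a3 * x 0 0 * x 1 0).

Definition P1 x : 'M[R]_3 :=
  mx3 [:: [:: 0;           k;                     - a3 * x 1 0];
          [:: - k;         0;                     - (a2 * a3 / a1) * x 0 0];
          [:: a3 * x 1 0;  a2 * a3 / a1 * x 0 0;  0]].

Definition H1 x : R :=
  (Gamma (q + 2))^-1 * (x 0 0 `^ (1 + q) - a1 / a3 * x 2 0 `^ (1 + q)).

Definition C1 x : R :=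
  (Gamma (q + 2))^-1 * (a2 * x 0 0 `^ (1 + q) - a1 * x 1 0 `^ (1 + q))
  - k * a1 / (Gamma (q + 1) * a3) * x 2 0 `^ q.

Definition P2 x : 'M[R]_3 :=
  mx3 [:: [:: 0;        x 2 0;            0];
          [:: - x 2 0;  0;                - (a3 / a1) * x 0 0];
          [:: 0;        a3 / a1 * x 0 0;  0]].

Definition H2 x : R :=
  (Gamma (q + 2))^-1 * (- a2 * x 0 0 `^ (1 + q) + a1 * x 1 0 `^ (1 + q))
  + k * a1 / (Gamma (q + 1) * a3) * x 2 0 `^ q.

Definition C2 x : R :=
  (Gamma (q + 2))^-1 * (a3 * x 0 0 `^ (1 + q) - a1 * x 2 0 `^ (1 + q)).

End EulerTop.

(* Main.v *)
Require Import Defs.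
From mathcomp Require Import measurable_realfun ring.

(** Every Hamiltonian and Casimir of the proposition is a sum of normalised
    powers, w / Gamma(n + q + 1) * (x^i)^(n + q) with n = 0 or n = 1, one for
    each coordinate.  The Caputo derivative of order q turns such a power into
    the monomial w * (x^i)^n, because
      D^q t^p = Gamma(p + 1) / Gamma(p + 1 - q) * t^(p - q)
    and Gamma(1) = Gamma(2) = 1.  The fractional gradients are therefore
    vectors of constants and linear forms, exactly as for the classical Euler
    top, and the identities f = P . grad^q H and P . grad^q C = 0 become
    products of 3 x 3 matrices (the latter gives a Casimir because P is
    skew-symmetric: [skew_kernel_casimir]).

    The analytic content is the power rule [caputo_powR].  For q < 1 the
    integral that defines the Caputo derivative of t^p is Euler's beta integral
    for the exponents 1 - q and p, so what is needed is
    B(a, b) = Gamma(a) Gamma(b) / Gamma(a + b).  It comes from [eGammaM]: a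
    product of two Gamma integrals is the integral of a convolution (Tonelli
    and translation invariance), and the convolution of two powers is again a
    power, times B(a, b) (scaling).  This is an identity between integrals of
    nonnegative functions, hence true in the extended reals before anything is
    known to converge; convergence, the recurrence
    Gamma(z + 1) = z Gamma(z) and integrability of the beta integrand are all
    drawn from it, starting from Gamma(1) = 1 and B(1, a) = 1 / a. *)

Local Open Scope classical_set_scope.
Local Open Scope ring_scope.

(** * Affine changes of variable *)

Section affine_change.
Context {R : realType}.
Local Notation mu := (@lebesgue_measure R).
Local Open Scope ereal_scope.

Lemma measurable_affine (c d : R) :
  measurable_fun setT (fun x : R => (c * x + d)%R : measurableTypeR R).
Proof. by apply: measurable_funD => //; exact: measurable_funM. Qed.

(** Both sides are measures in A and agree on half-open intervals. *)
Lemma lebesgue_measure_affine (c d : R) (A : set R) : (0 < c)%R ->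
  measurable A ->
  mu A =
  c%:E * pushforward mu (fun x : R => (c * x + d)%R : measurableTypeR R) A.
Proof.
move=> c0 mA; pose k : {nonneg R} := NngNum (ltW c0).
have -> : c = k%:num by [].
have := @lebesgue_measure_unique R
  (mscale k (pushforward mu (fun x : R => (c * x + d)%R : measurableTypeR R))).
move=> /(_ (measurable_affine c d)); apply => // _ [[a b]] _ <-.
have pre : (fun x : R => c * x + d)%R @^-1` `]a, b] =
    `]((a - d) / c)%R, ((b - d) / c)%R]%classic.
  apply/seteqP; split => x /=; rewrite !in_itv/=;
    by rewrite ltr_pdivrMr// ler_pdivlMr// ltrBlDr lerBrDr (mulrC x).
rewrite [RHS](_ : _ = c%:E * mu ((fun x : R => c * x + d)%R @^-1` `]a, b]))//.
rewrite pre !lebesgue_measure_itv/= !lte_fin ltr_pM2r ?invr_gt0// ltrD2r.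
case: ifPn => _; last by rewrite mule0.
rewrite -!EFinB -EFinM; congr EFin.
by field; rewrite gt_eqF.
Qed.

(** Change of variable for merely measurable integrands on any measurable
    domain: the beta and Gamma integrands are singular at the endpoints, where
    substitution rules for continuous functions do not apply. *)
Lemma ge0_integral_affine (c d : R) (D : set R) (f : R -> \bar R) :
  (0 < c)%R -> measurable D -> measurable_fun D f ->
  (forall x, D x -> 0 <= f x) ->
  \int[mu]_(y in D) f y =
  c%:E * \int[mu]_(x in (fun x => c * x + d)%R @^-1` D) f (c * x + d)%R.
Proof.
move=> c0 mD mf f0; pose k : {nonneg R} := NngNum (ltW c0).
have mA := measurable_affine c d.
rewrite -(@ge0_integral_pushforward _ _ (measurableTypeR R) (measurableTypeR R)
  R _ mA mu D f) //; last by move=> y; rewrite inE; exact: f0.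
have -> : c = k%:num by [].
rewrite -[RHS](@ge0_integral_mscale)//.
by apply: eq_measure_integral => A mB _; exact: lebesgue_measure_affine.
Qed.

End affine_change.

(** * Euler's Gamma and beta integrals *)

Section Gamma_Beta.
Context {R : realType}.
Local Notation mu := (@lebesgue_measure R).
Implicit Types a b z t s : R.
Local Open Scope ereal_scope.

(** Extended-real integrals, so that Tonelli's theorem and the functional
    equations apply to them before convergence is established. *)
Definition eGamma z : \bar R :=
  \int[mu]_(t in `]0%R, +oo[) (t `^ (z - 1) * expR (- t))%:E.

Definition eBeta a b : \bar R :=
  \int[mu]_(s in `]0%R, 1%R[) ((1 - s) `^ (a - 1) * s `^ (b - 1))%:E.

Lemma eGamma_ge0 z : 0 <= eGamma z.
Proof.
apply: integral_ge0 => t _.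
by rewrite lee_fin mulr_ge0 ?powR_ge0 ?expR_ge0.
Qed.

Lemma eBeta_ge0 a b : 0 <= eBeta a b.
Proof.
by apply: integral_ge0 => t _; rewrite lee_fin mulr_ge0// powR_ge0.
Qed.

Lemma GammaE z : Gamma z = fine (eGamma z). Proof. by []. Qed.

Lemma measurable_powR_comp (p : R) (h : R -> R) (D : set R) :
  measurable_fun D h -> measurable_fun D (fun x => h x `^ p)%R.
Proof. by move=> mh; apply: (measurableT_comp (measurable_powR p)). Qed.

Lemma measurable_beta_integrand a b t D :
  measurable_fun D (fun s : R => (t - s) `^ (a - 1) * s `^ (b - 1))%R.
Proof.
apply: measurable_funM; apply: measurable_powR_comp => //.
by apply: measurable_funTS; exact: measurable_funB.
Qed.

Lemma measurable_gamma_integrand z D :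
  measurable_fun D (fun t : R => t `^ (z - 1) * expR (- t))%R.
Proof.
apply: measurable_funM; first exact: measurable_powR_comp.
by apply: measurable_funTS; apply: measurableT_comp.
Qed.

(** The substitution s = t u pulls a power of t out of the integral. *)
Lemma integral_beta_scale a b t : (0 < t)%R ->
  \int[mu]_(s in `]0%R, t[) ((t - s) `^ (a - 1) * s `^ (b - 1))%:E =
  (t `^ (a + b - 1))%:E * eBeta a b.
Proof.
have mB u D : measurable_fun D
    (fun s : R => ((u - s) `^ (a - 1) * s `^ (b - 1))%:E).
  by apply/measurable_EFinP; exact: measurable_beta_integrand.
have B0 u s : 0 <= ((u - s) `^ (a - 1) * s `^ (b - 1))%:E.
  by rewrite lee_fin mulr_ge0// powR_ge0.
move=> t0.
rewrite [LHS](@ge0_integral_affine _ t 0 `]0%R, t[ _ t0 _ (mB t _)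
  (fun s _ => B0 t s)).
  2: by [].
rewrite (_ : _ @^-1` _ = `]0%R, 1%R[%classic); last first.
  apply/seteqP; split => x /=; rewrite !in_itv/= addr0;
    by rewrite pmulr_rgt0// gtr_pMr.
rewrite (_ : t `^ (a + b - 1) = t * t `^ ((a - 1) + (b - 1)))%R; last first.
  rewrite -[X in (X * _)%R](powRr1 (ltW t0)) -powRD ?(gt_eqF t0) ?implybT//.
  by congr (_ `^ _)%R; ring.
rewrite EFinM -muleA; congr (_ * _).
rewrite -ge0_integralZl ?lee_fin ?powR_ge0//; last exact: mB.
apply: eq_integral => s; rewrite inE/= in_itv/= => /andP[s0 s1].
rewrite -EFinM; congr EFin.
rewrite addr0 (_ : t - t * s = t * (1 - s))%R; last by ring.
rewrite !powRM ?(ltW t0) ?(ltW s0) ?subr_ge0 ?(ltW s1)//.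
by rewrite (@powRD _ t (a - 1) (b - 1)) ?(gt_eqF t0) ?implybT//; ring.
Qed.

(** Extended by 0 to the whole line, so that the convolution of two Gamma
    integrands is an integral over R and can be translated freely. *)
Let g z t : R := (\1_`]0%R, +oo[ t * (t `^ (z - 1) * expR (- t)))%R.

Let g_ge0 z t : (0 <= g z t)%R.
Proof. by rewrite /g mulr_ge0 ?mulr_ge0 ?powR_ge0 ?expR_ge0. Qed.

Let mg z : measurable_fun setT (g z).
Proof.
by apply: measurable_funM; [exact: measurable_indic|
  exact: measurable_gamma_integrand].
Qed.

Let eGamma_indic z : eGamma z = \int[mu]_t (g z t)%:E.
Proof.
rewrite /eGamma integral_mkcond; apply: eq_integral => t _.
by rewrite patchE /g indicE; case: ifPn => _; rewrite ?mul1r ?mul0r.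
Qed.

Let gE z t : g z t = (if 0 < t then t `^ (z - 1) * expR (- t) else 0)%R.
Proof.
rewrite /g indicE; have [t0|t0] := ltP 0%R t.
  by rewrite mem_set ?mul1r//= in_itv/= t0.
by rewrite memNset ?mul0r//= in_itv/= ltNge t0.
Qed.

(** The exponentials combine into exp(-t), which leaves the beta integral on
    ]0, t[. *)
Let g_conv a b t : \int[mu]_s (g b s * g a (t - s))%:E =
  eBeta a b * (g (a + b) t)%:E.
Proof.
have [t0|t0] := leP t 0%R.
  rewrite integral0_eq; last first.
    move=> s _; congr EFin; rewrite !gE subr_gt0.
    have [s0|] := ltP 0%R s; last by rewrite mul0r.
    by rewrite ltNge (le_trans t0 (ltW s0))/= mulr0.
  by rewrite gE ltNge t0/= mule0.
transitivity (\int[mu]_(s in `]0%R, t[)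
    ((expR (- t))%:E * ((t - s) `^ (a - 1) * s `^ (b - 1))%:E)).
  rewrite [RHS]integral_mkcond; apply: eq_integral => s _.
  rewrite patchE !gE subr_gt0; have [s0|s0] := ltP 0%R s; last first.
    by rewrite mul0r memNset//= in_itv/= ltNge s0.
  have [st|st] := ltP s t; last first.
    by rewrite mulr0 memNset//= in_itv/= s0/= ltNge st.
  rewrite mem_set/= ?in_itv/= ?s0// -EFinM; congr EFin.
  by rewrite (_ : - t = - s + (- (t - s)))%R ?expRD; ring.
rewrite ge0_integralZl ?lee_fin ?expR_ge0//; first last.
- by move=> s _; rewrite lee_fin mulr_ge0// powR_ge0.
- by apply/measurable_EFinP; exact: measurable_beta_integrand.
rewrite integral_beta_scale// gE t0.
by rewrite muleA -EFinM muleC mulrC.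
Qed.

(** Tonelli: the integral of a convolution is the product of the integrals.
    With the convention 0 * +oo = 0 this holds for all real a and b. *)
Lemma eGammaM a b : eGamma a * eGamma b = eBeta a b * eGamma (a + b).
Proof.
transitivity (\int[mu]_s \int[mu]_t (g b s * g a (t - s))%:E).
  rewrite muleC [eGamma b]eGamma_indic.
  rewrite -ge0_integralZr ?eGamma_ge0//; first last.
  - by move=> s _; rewrite lee_fin g_ge0.
  - by apply/measurable_EFinP; exact: mg.
  apply: eq_integral => s _.
  under [RHS]eq_integral do rewrite EFinM.
  rewrite ge0_integralZl//; first last.
  - by rewrite lee_fin g_ge0.
  - by move=> t _; rewrite lee_fin g_ge0.
  - apply/measurable_EFinP; apply: (measurableT_comp (mg a)).
    exact: measurable_funB.
  congr (_ * _); rewrite eGamma_indic (@ge0_integral_affine _ 1 (- s))//.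
  - rewrite mul1e preimage_setT; apply: eq_integral => t _.
    by rewrite mul1r.
  - by apply/measurable_EFinP; exact: mg.
  - by move=> t _; rewrite lee_fin g_ge0.
rewrite (@fubini_tonelli _ _ _ _ _ mu mu
  (fun p : R * R => (g b p.1 * g a (p.2 - p.1))%:E))/=; first last.
- by move=> p; rewrite lee_fin mulr_ge0.
- apply/measurable_EFinP; apply: measurable_funM.
    exact: (measurableT_comp (mg b)).
  apply: (measurableT_comp (mg a)); exact: measurable_funB.
rewrite [eGamma (a + b)]eGamma_indic -ge0_integralZl ?eBeta_ge0//; first last.
- by move=> t _; rewrite lee_fin g_ge0.
- by apply/measurable_EFinP; exact: mg.
by apply: eq_integral => t _; exact: g_conv.
Qed.

Lemma eGamma1 : eGamma 1 = 1 :> \bar R.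
Proof.
rewrite -(@integral_exponential_pdf R 1)// /eGamma.
rewrite integral_itv_obnd_cbnd; last first.
  by apply/measurable_EFinP; exact: measurable_gamma_integrand.
rewrite integral_mkcond; apply: eq_integral => t _.
rewrite /exponential_pdf !patchE; case: ifPn => // _.
by rewrite subrr powRr0 mulN1r.
Qed.

Let is_derive_primitive a s : (0 < a)%R -> (0 < s)%R ->
  is_derive s 1%R (fun s : R => a^-1 * s `^ a)%R (s `^ (a - 1))%R.
Proof.
move=> a0 s0; have := is_deriveZ a^-1 (is_derive1_powR a s0).
by rewrite /GRing.scale/= mulrA mulVf ?mul1r ?gt_eqF.
Qed.

Let FTC_powR a e : (0 < a)%R -> (0 < e < 1)%R ->
  \int[mu]_(s in `[e, 1%R]) (s `^ (a - 1))%:E = (a^-1 * (1 - e `^ a))%:E.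
Proof.
move=> a0 /andP[e0 e1].
have dF s : (e <= s)%R ->
    is_derive s 1%R (fun s : R => a^-1 * s `^ a)%R (s `^ (a - 1))%R.
  by move=> es; apply: is_derive_primitive => //; exact: lt_le_trans es.
have cF s : (e <= s)%R -> {for s, continuous (fun s : R => a^-1 * s `^ a)%R}.
  move=> es; apply: differentiable_continuous; apply/derivable1_diffP.
  by apply: ex_derive; exact: dF.
rewrite (@continuous_FTC2 _ _ (fun s : R => a^-1 * s `^ a)%R)//.
- by rewrite -EFinB powR1 mulrBr mulr1.
- apply: derivable_within_continuous => s; rewrite in_itv/= => /andP[es _].
  by apply: derivable_powR; rewrite in_itv/= andbT (lt_le_trans e0).
- split.
  + move=> s; rewrite in_itv/= => /andP[es _].
    by apply: ex_derive; apply: dF; exact: ltW.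
  + by apply: cvg_at_right_filter; exact: cF.
  + by apply: cvg_at_left_filter; apply: cF; exact: ltW.
- move=> s; rewrite in_itv/= => /andP[es _].
  by rewrite derive1E; apply: derive_val; apply: dF; exact: ltW.
Qed.

(** The integrand is unbounded at 0 for a < 1, so the fundamental theorem of
    calculus is used on [1 / (n + 2), 1] and n tends to infinity. *)
Lemma eBeta1 a : (0 < a)%R -> eBeta 1 a = (a^-1)%:E.
Proof.
move=> a0.
have mp D : measurable_fun D (fun s : R => (s `^ (a - 1))%:E).
  by apply/measurable_EFinP; exact: measurable_powR_comp.
transitivity (\int[mu]_(s in `]0%R, 1%R]) (s `^ (a - 1))%:E).
  rewrite -integral_itv_bndo_bndc; last exact: mp.
  by apply: eq_integral => s _; rewrite subrr powRr0 mul1r.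
(* n + 2, so that every interval [e n, 1] is nondegenerate. *)
pose e n : R := (n.+2%:R^-1)%R.
have e0 n : (0 < e n)%R by rewrite invr_gt0.
have e1 n : (e n < 1)%R by rewrite invf_lt1// ltr1n.
have ecvg : e n @[n --> \oo] --> 0%R.
  by have := @cvg_harmonic R; rewrite -cvg_shiftS.
pose F n : set R := `[e n, 1%R]%classic.
have -> : `]0%R, 1%R]%classic = \bigcup_n F n.
  apply/seteqP; split => [s|s [n _]]; rewrite /F/= !in_itv/= => /andP[es s1].
    have /cvgrPdist_lt/(_ _ es)[n _ /(_ n (leqnn n))] := ecvg.
    rewrite sub0r normrN ger0_norm ?ltW// => ens.
    by exists n => //; rewrite /F/= in_itv/= s1 (ltW ens).
  by rewrite s1 andbT (lt_le_trans (e0 n)).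
have mF n : measurable (F n) by exact: measurable_itv.
have ndF : nondecreasing_seq F.
  apply/nondecreasing_seqP => n; rewrite subsetEset => s.
  rewrite /F/= !in_itv/= => /andP[es ->]; rewrite andbT (le_trans _ es)//.
  by rewrite lef_pV2 ?posrE// ler_nat.
have H : \int[mu]_(s in F n) (s `^ (a - 1))%:E @[n --> \oo] -->
    \int[mu]_(s in \bigcup_n F n) (s `^ (a - 1))%:E.
  apply: ge0_nondecreasing_set_cvg_integral => //.
  - by move=> n; exact: mp.
  - by move=> n s _; rewrite lee_fin powR_ge0.
apply: (cvg_unique _ H) => //=.
under eq_fun do rewrite FTC_powR ?e0 ?e1//.
apply: cvg_EFin; first by apply: nearW.
rewrite -[X in _ --> X]mulr1; apply: cvgMr.
rewrite -[X in _ --> X]subr0; apply: cvgB; first exact: cvg_cst.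
by have /cvg_at_rightP := powR_cvg0 a0; apply.
Qed.

(** [eGammaM] for a = 1. It also holds when both sides are infinite, so it
    carries finiteness from z + 1 to z. *)
Lemma eGamma_rec z : (0 < z)%R -> eGamma z = (z^-1)%:E * eGamma (z + 1).
Proof.
move=> z0; rewrite -[LHS]mul1e -eGamma1 eGammaM.
by rewrite (eBeta1 _ z0) [(1 + z)%R]addrC.
Qed.

Lemma eGamma_nat_fin n : eGamma n.+1%:R \is a @fin_num R.
Proof.
elim: n => [|n IH]; first by rewrite eGamma1.
rewrite (_ : eGamma n.+2%:R = n.+1%:R%:E * eGamma n.+1%:R).
  by rewrite fin_numM.
rewrite [in RHS]eGamma_rec ?ltr0Sn// muleA -EFinM divff ?pnatr_eq0// mul1e.
by rewrite natr1.
Qed.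

(** By the recurrence it suffices to bound the integral at z + 1, where
    t^z <= 1 + t^n for any natural number n >= z. *)
Lemma eGamma_fin_num z : (0 < z)%R -> eGamma z \is a fin_num.
Proof.
move=> z0; rewrite eGamma_rec// fin_numM// ge0_fin_numE ?eGamma_ge0//.
pose n := Num.bound z.
have zn : (z <= n%:R)%R by apply/ltW/archi_boundP/ltW.
apply: (@le_lt_trans _ _ (eGamma 1 + eGamma n.+1%:R)); last first.
  by rewrite lte_add_pinfty// ltey_eq ?eGamma1 ?eGamma_nat_fin.
have p0 (a t : R) : (0 <= t `^ (a - 1) * expR (- t))%R.
  by rewrite mulr_ge0 ?powR_ge0 ?expR_ge0.
have mG a D : measurable_fun D (fun t : R => (t `^ (a - 1) * expR (- t))%:E).
  by apply/measurable_EFinP; exact: measurable_gamma_integrand.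
rewrite -ge0_integralD//; last 4 first.
- by move=> t _; rewrite lee_fin p0.
- exact: mG.
- by move=> t _; rewrite lee_fin p0.
- exact: mG.
apply: ge0_le_integral => //.
- by move=> t _; rewrite lee_fin p0.
- exact: mG.
- by apply: emeasurable_funD; exact: mG.
move=> t; rewrite /= in_itv/= andbT => t0.
rewrite -EFinD lee_fin -mulrDl ler_wpM2r ?expR_ge0//.
rewrite -natr1 !addrK subrr powRr0.
have [t1|t1] := leP t 1%R.
  rewrite (@le_trans _ _ 1%R) ?lerDl ?powR_ge0//.
  by rewrite -[leRHS](powRr0 t) ger_powR ?t0 ?t1// ltW.
by rewrite (@le_trans _ _ (t `^ n%:R)%R) ?lerDr// ler_powR// ltW.
Qed.

Lemma eGammaE z : (0 < z)%R -> eGamma z = (Gamma z)%:E.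
Proof. by move=> z0; rewrite GammaE fineK// eGamma_fin_num. Qed.

Lemma Gamma1 : Gamma 1 = 1%R :> R.
Proof. by rewrite GammaE eGamma1. Qed.

Lemma GammaS z : (0 < z)%R -> Gamma (z + 1) = (z * Gamma z)%R.
Proof.
move=> z0; have := eGamma_rec _ z0.
rewrite !eGammaE ?addr_gt0// -EFinM => -[->].
by rewrite mulrA divff ?mul1r// gt_eqF.
Qed.

(** Moving to z + 1 makes the power at least 1 on [1, 2]. *)
Lemma Gamma_gt0 z : (0 < z)%R -> (0 < Gamma z)%R.
Proof.
move=> z0; rewrite -(pmulr_rgt0 _ z0) -GammaS// -lte_fin -eGammaE ?addr_gt0//.
have p0 t : (0 <= t `^ (z + 1 - 1) * expR (- t))%R.
  by rewrite mulr_ge0 ?powR_ge0 ?expR_ge0.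
have mG D : measurable_fun D (fun t : R => (t `^ (z + 1 - 1) * expR (- t))%:E).
  by apply/measurable_EFinP; exact: measurable_gamma_integrand.
apply: (@lt_le_trans _ _ (\int[mu]_(t in `[1%R, 2%R]) (expR (- 2))%:E)).
  rewrite integral_cst//= lebesgue_measure_itv/= lte_fin ltr1n/= -EFinB -EFinM.
  by rewrite lte_fin mulr_gt0 ?expR_gt0// subr_gt0 ltr1n.
apply: (@le_trans _ _ (\int[mu]_(t in `[1%R, 2%R])
   (t `^ (z + 1 - 1) * expR (- t))%:E)).
  apply: ge0_le_integral => //.
  - exact: mG.
  - move=> t; rewrite /= in_itv/= => /andP[t1 t2]; rewrite lee_fin.
    rewrite -[leLHS]mul1r ler_pM ?expR_ge0//; last by rewrite ler_expR lerN2.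
    by rewrite addrK -[leLHS](powRr0 t) ler_powR// ltW.
apply: ge0_subset_integral => //.
- exact: mG.
- by move=> t _; rewrite lee_fin p0.
- by move=> t; rewrite /= !in_itv/= andbT => /andP[t1 _]; exact: lt_le_trans t1.
Qed.

Lemma eBetaE a b : (0 < a)%R -> (0 < b)%R ->
  eBeta a b = (Gamma a * Gamma b / Gamma (a + b))%:E.
Proof.
move=> a0 b0; have ab0 := addr_gt0 a0 b0; have := eGammaM a b.
have G0 : Gamma (a + b) != 0%R by rewrite gt_eqF// Gamma_gt0.
rewrite !eGammaE// EFinM EFinM => ->; rewrite -muleA -EFinM divff//.
by rewrite mule1.
Qed.

End Gamma_Beta.

(** * The Caputo derivative of a power *)

Section Caputo_powers.
Context {R : realType}.
Local Notation mu := (@lebesgue_measure R).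
Implicit Types (q p c d t s : R) (x : 'cV[R]_3).

Lemma integrable_beta_integrand a b t : 0 < a -> 0 < b -> 0 < t ->
  mu.-integrable `]0, t[
    (EFin \o (fun s => (t - s) `^ (a - 1) * s `^ (b - 1))).
Proof.
move=> a0 b0 t0; apply/integrableP; split.
  by apply/measurable_EFinP; exact: measurable_beta_integrand.
under eq_integral.
  move=> s _; rewrite /= ger0_norm ?mulr_ge0 ?powR_ge0//; over.
by rewrite integral_beta_scale// eBetaE// ltey.
Qed.

Lemma is_derive_affine_powR p c d s : 0 < s ->
  is_derive s 1 (fun s => c * s `^ p + d) (c * p * s `^ (p - 1)).
Proof.
move=> s0.
have := is_deriveD (is_deriveZ c (is_derive1_powR p s0)) (is_derive_cst d s 1).
by rewrite /GRing.scale/= addr0 mulrA.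
Qed.

(** The constant d stands for the coordinates that are held fixed in a partial
    derivative. At q = 1 the quotient of Gamma values is p, which gives the
    ordinary power rule. *)
Lemma caputo_powR q p c d t : 0 < q <= 1 -> 0 < p -> 0 < t ->
  caputo_derivable q (fun s => c * s `^ p + d) t /\
  caputo q (fun s => c * s `^ p + d) t =
    c * (Gamma (p + 1) / Gamma (p + 1 - q)) * t `^ (p - q).
Proof.
move=> /andP[q0 q1] p0 t0; rewrite /caputo_derivable /caputo.
have dE s : 0 < s ->
    derive1 (fun s => c * s `^ p + d) s = c * p * s `^ (p - 1).
  move=> s0; rewrite derive1E; apply: derive_val.
  exact: is_derive_affine_powR.
case: eqP => [->|/eqP qn1].
  split; first by apply: ex_derive; exact: is_derive_affine_powR.
  by rewrite dE// GammaS// addrK mulfK// gt_eqF// Gamma_gt0.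
have q1' : 0 < 1 - q by rewrite subr_gt0 lt_neqAle qn1.
have intE s : s \in `]0, t[%classic ->
    caputo_integrand q (fun s => c * s `^ p + d) t s =
    c * p * ((t - s) `^ (1 - q - 1) * s `^ (p - 1)).
  rewrite inE/= in_itv/= => /andP[s0 _].
  rewrite /caputo_integrand dE// (_ : 1 - q - 1 = - q); last by ring.
  by ring.
have iB := integrable_beta_integrand _ _ _ q1' p0 t0.
split; [split|].
- by move=> s /andP[s0 _]; apply: ex_derive; exact: is_derive_affine_powR.
- have := integrableZl _ (c * p) iB => /(_ (measurable_itv _)).
  apply: eq_integrable => // s sI.
  by rewrite /= intE.
have -> : \int[mu]_(s in `]0, t[)
      caputo_integrand q (fun s => c * s `^ p + d) t s =
    c * p * \int[mu]_(s in `]0, t[) ((t - s) `^ (1 - q - 1) * s `^ (p - 1)).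
  by rewrite -RintegralZl//; exact: eq_Rintegral.
rewrite /Rintegral integral_beta_scale// eBetaE//= GammaS//.
rewrite (_ : 1 - q + p - 1 = p - q); last by ring.
rewrite (_ : 1 - q + p = p + 1 - q); last by ring.
have G1q : Gamma (1 - q) != 0 by rewrite gt_eqF// Gamma_gt0.
have G2 : Gamma (p + 1 - q) != 0.
  by rewrite gt_eqF// Gamma_gt0// -addrA addr_gt0.
(* As variables, the Gamma values are not unfolded by the field tactic. *)
move: G1q G2; move: (Gamma (1 - q)) (Gamma (p + 1 - q)) (t `^ _) => g1 g2 u.
move=> g1n0 g2n0; by field; apply/andP; split.
Qed.

(** For p = n + q with n = 0 or n = 1, Gamma(p + 1 - q) is Gamma(1) or
    Gamma(2), both equal to 1. *)
Lemma caputo_monomial q (n : bool) c d t : 0 < q <= 1 -> 0 < t ->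
  let f s := c / Gamma (n%:R + q + 1) * s `^ (n%:R + q) + d in
  caputo_derivable q f t /\ caputo q f t = c * t ^+ n.
Proof.
move=> hq t0 f; have q0 : 0 < q by case/andP: hq.
have nq : 0 < n%:R + q by rewrite ltr_wpDl.
have [df ->] := caputo_powR _ _ (c / Gamma (n%:R + q + 1)) d _ hq nq t0.
split=> //; rewrite (_ : n%:R + q + 1 - q = n%:R + 1); last by ring.
rewrite addrK powR_mulrn ?ltW// (_ : Gamma (n%:R + 1) = 1); last first.
  by case: (n); rewrite ?add0r ?Gamma1// GammaS ?Gamma1 ?mulr1.
by rewrite divr1 mulfVK// gt_eqF// Gamma_gt0// addr_gt0.
Qed.

(** * Fractional gradients and Casimirs *)

(** The common shape of the Hamiltonians and Casimirs; the Gamma factors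
    normalise the powers so that w holds the coefficients of the fractional
    gradient. *)
Definition power_sum q (w : 'cV[R]_3) (n : 'I_3 -> bool) x : R :=
  \sum_i w i 0 / Gamma ((n i)%:R + q + 1) * x i 0 `^ ((n i)%:R + q).

Lemma slice_power_sum q w (n : 'I_3 -> bool) x i : slice (power_sum q w n) x i =
  fun s => w i 0 / Gamma ((n i)%:R + q + 1) * s `^ ((n i)%:R + q) +
    \sum_(j | j != i)
      w j 0 / Gamma ((n j)%:R + q + 1) * x j 0 `^ ((n j)%:R + q).
Proof.
apply/funext => s; rewrite /slice /power_sum (bigD1 i)//= mxE eqxx.
by congr (_ + _); apply: eq_bigr => j ji; rewrite mxE (negbTE ji).
Qed.

Lemma caputo_grad_power_sum q w n x : 0 < q <= 1 -> positive_point x ->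
  caputo_differentiable q (power_sum q w n) x /\
  caputo_grad q (power_sum q w n) x = \col_i (w i 0 * x i 0 ^+ n i).
Proof.
move=> hq x0; split=> [i|].
  by rewrite slice_power_sum; apply: (caputo_monomial _ _ _ _ _ hq (x0 i)).1.
apply/colP => i; rewrite !mxE /caputo_partial slice_power_sum.
exact: (caputo_monomial _ _ _ _ _ hq (x0 i)).2.
Qed.

(** Skew-symmetry turns the left kernel condition contained in the bracket
    [C, g] into the right one P . grad^q C = 0. *)
Lemma skew_kernel_casimir q (P : 'cV[R]_3 -> 'M[R]_3) (C : 'cV[R]_3 -> R) :
  (forall x, (P x)^T = - P x) ->
  (forall x, positive_point x ->
     caputo_differentiable q C x /\ P x *m caputo_grad q C x = 0) ->
  fractional_casimir q P C.
Proof.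
move=> skew ker x x0; have [dC PC] := ker x x0; split=> // g.
rewrite /leibniz_bracket exchange_big big1//= => j _; rewrite -mulr_suml.
rewrite (_ : \sum_i _ = - (P x *m caputo_grad q C x) j 0).
  by rewrite PC mxE oppr0 mul0r.
rewrite mxE -sumrN; apply: eq_bigr => i _.
have /matrixP/(_ j i) := skew x; rewrite !mxE => ->.
by rewrite mulNr.
Qed.

End Caputo_powers.

(** * Vectors and matrices of order three *)

Section Order3.
Context {R : realType}.

Lemma ord3P (Q : 'I_3 -> Prop) : Q 0 -> Q 1 -> Q 2 -> forall i, Q i.
Proof.
move=> Q0 Q1 Q2 [[|[|[|//]]] i3];
  by [rewrite (_ : Ordinal i3 = 0)//; exact: val_inj
     |rewrite (_ : Ordinal i3 = 1)//; exact: val_inj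
     |rewrite (_ : Ordinal i3 = 2)//; exact: val_inj].
Qed.

Lemma sum3 (F : 'I_3 -> R) : \sum_i F i = F 0 + F 1 + F 2.
Proof.
rewrite !big_ord_recl big_ord0 addr0 addrA.
by congr (F _ + F _ + F _); exact: val_inj.
Qed.

Lemma mulmx3 (a b c d e f g h i u v w : R) :
  mx3 [:: [:: a; b; c]; [:: d; e; f]; [:: g; h; i]] *m vec3 u v w =
  vec3 (a * u + b * v + c * w) (d * u + e * v + f * w) (g * u + h * v + i * w).
Proof. by apply/colP; elim/ord3P; rewrite !mxE sum3 !mxE. Qed.

Lemma mx3_skew (a b c : R) :
  let P := mx3 [:: [:: 0; a; b]; [:: - a; 0; c]; [:: - b; - c; 0]] in
  P^T = - P.
Proof.
by apply/matrixP; elim/ord3P; elim/ord3P; rewrite !mxE /= ?oppr0 ?opprK.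
Qed.

End Order3.

(** * The fractional Euler top *)

Section Euler_top_functions.
Context {R : realType}.
Variables q a1 a2 a3 k : R.

Lemma power_sum3 (a b c : R) (n : 'I_3 -> bool) :
  power_sum q (vec3 a b c) n = fun x =>
    a / Gamma ((n 0)%:R + q + 1) * x 0 0 `^ ((n 0)%:R + q) +
    b / Gamma ((n 1)%:R + q + 1) * x 1 0 `^ ((n 1)%:R + q) +
    c / Gamma ((n 2)%:R + q + 1) * x 2 0 `^ ((n 2)%:R + q).
Proof. by apply/funext => x; rewrite /power_sum sum3 !mxE. Qed.

Lemma caputo_grad_power_sum3 (a b c : R) (n : 'I_3 -> bool)
    (x : 'cV[R]_3) :
  0 < q <= 1 -> positive_point x ->
  caputo_differentiable q (power_sum q (vec3 a b c) n) x /\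
  caputo_grad q (power_sum q (vec3 a b c) n) x =
    vec3 (a * x 0 0 ^+ n 0) (b * x 1 0 ^+ n 1) (c * x 2 0 ^+ n 2).
Proof.
move=> hq x0; have [? ->] := caputo_grad_power_sum q (vec3 a b c) n x hq x0.
by split=> //; apply/colP; elim/ord3P; rewrite !mxE.
Qed.

Lemma H1E : H1 q a1 a3 = power_sum q (vec3 1 0 (- (a1 / a3))) xpredT.
Proof.
rewrite power_sum3; apply/funext => x; rewrite /H1 /=.
rewrite (_ : 1 + q + 1 = q + 2); last by ring.
by move: (Gamma _) => g; ring.
Qed.

Lemma C2E : C2 q a1 a3 = power_sum q (vec3 a3 0 (- a1)) xpredT.
Proof.
rewrite power_sum3; apply/funext => x; rewrite /C2 /=.
rewrite (_ : 1 + q + 1 = q + 2); last by ring.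
by move: (Gamma _) => g; ring.
Qed.

Lemma C1E : C1 q a1 a2 a3 k =
  power_sum q (vec3 a2 (- a1) (- (k * a1 / a3))) (fun i => i != 2).
Proof.
rewrite power_sum3; apply/funext => x; rewrite /C1 /= add0r invfM.
rewrite (_ : 1 + q + 1 = q + 2); last by ring.
by move: (Gamma (q + 2)) (Gamma (q + 1)) => g g'; ring.
Qed.

Lemma H2E : H2 q a1 a2 a3 k =
  power_sum q (vec3 (- a2) a1 (k * a1 / a3)) (fun i => i != 2).
Proof.
rewrite power_sum3; apply/funext => x; rewrite /H2 /= add0r invfM.
rewrite (_ : 1 + q + 1 = q + 2); last by ring.
by move: (Gamma (q + 2)) (Gamma (q + 1)) => g g'; ring.
Qed.

End Euler_top_functions.

Theorem proposition2p1 (R : realType) (q a1 a2 a3 k : R)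
    (hq : 0 < q <= 1) (ha : a1 * a2 * a3 != 0) :
  (almost_poisson_realization q (euler_top a1 a2 a3 k)
     (P1 a1 a2 a3 k) (H1 q a1 a3) /\
   fractional_casimir q (P1 a1 a2 a3 k) (C1 q a1 a2 a3 k)) /\
  (almost_poisson_realization q (euler_top a1 a2 a3 k)
     (P2 a1 a3) (H2 q a1 a2 a3 k) /\
   fractional_casimir q (P2 a1 a3) (C2 q a1 a3)).
Proof.
have [a1n0 a3n0] : a1 != 0 /\ a3 != 0.
  by move: ha; rewrite !mulf_eq0 !negb_or => /andP[/andP[]].
have skew1 x : (P1 a1 a2 a3 k x)^T = - P1 a1 a2 a3 k x.
  have := mx3_skew k (- a3 * x 1 0) (- (a2 * a3 / a1) * x 0 0).
  by rewrite /= !mulNr !opprK /P1 !mulNr.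
have skew2 x : (P2 a1 a3 x)^T = - P2 a1 a3 x.
  have := mx3_skew (x 2 0) 0 (- (a3 / a1) * x 0 0).
  by rewrite /= !mulNr !opprK oppr0 /P2 !mulNr.
have zero3 : vec3 0 0 0 = 0 :> 'cV[R]_3.
  by apply/colP; elim/ord3P; rewrite !mxE.
split; split.
- split=> // x x0; rewrite H1E /euler_top.
  have [? ->] := caputo_grad_power_sum3 q
    1 0 (- (a1 / a3)) xpredT x hq x0.
  split=> //; rewrite mulmx3 /= !expr1; congr vec3;
    by field; rewrite ?a1n0 ?a3n0.
- apply: skew_kernel_casimir => // x x0; rewrite C1E -zero3.
  have [? ->] := caputo_grad_power_sum3 q
    a2 (- a1) (- (k * a1 / a3)) (fun i => i != 2) x hq x0.
  split=> //; rewrite mulmx3 /= !expr1 expr0; congr vec3;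
    by field; rewrite ?a1n0 ?a3n0.
- split=> // x x0; rewrite H2E /euler_top.
  have [? ->] := caputo_grad_power_sum3 q
    (- a2) a1 (k * a1 / a3) (fun i => i != 2) x hq x0.
  split=> //; rewrite mulmx3 /= !expr1 expr0; congr vec3;
    by field; rewrite ?a1n0 ?a3n0.
- apply: skew_kernel_casimir => // x x0; rewrite C2E -zero3.
  have [? ->] := caputo_grad_power_sum3 q
    a3 0 (- a1) xpredT x hq x0.
  split=> //; rewrite mulmx3 /= !expr1; congr vec3;
    by field; rewrite ?a1n0 ?a3n0.
Qed.
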